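(* Let $W$ be a well labelled spider obtained by performing operation R3 on a thin spider $G=(S,C,H)$ onto $t\geq 1$ vertices in $S$ (that is, $t$ vertices of $S$ are each replaced by a graph with two vertices). Then $\gamma_{\{R2\}}(W)= \gamma_{\{R2\}}(G)+t-1$.
   Context: All graphs are finite, undirected and simple. For a graph $G=(V,E)$, a function $f:V\to\{0,1,2\}$ is a Roman $\{2\}$-dominating function of $G$ if for every $v\in V$ with $f(v)=0$, either $v$ has a neighbor $u$ with $f(u)=2$, or $v$ has two distinct neighbors $x,y$ with $f(x)=f(y)=1$. The weight of $f$ is $\sum_{v\in V}f(v)$, and $\gamma_{\{R2\}}(G)$ is the minimum weight of a Roman $\{2\}$-dominating function of $G$. A thin spider with spider partition $(S,C,H)$ is a graph whose vertex set is partitioned into $S,C,H$ ($H$ possibly empty), where $S=\{s_1,\ldots,s_r\}$ is a stable set and $C=\{c_1,\ldots,c_r\}$ is a clique, $r\geq 2$, every vertex of $H$ is adjacent to every vertex of $C$ and to no vertex of $S$, and $s_i$ is adjacent to $c_j$ if and only if $i=j$; the edges $s_ic_i$ are its legs. Replacing a vertex $v$ by a graph $F$ means deleting $v$, adding a disjoint copy of $F$, and joining every vertex of $F$ to every neighbor of $v$. Operation R3 on a thin spider $(S,C,H)$: replace at most one endpoint of every leg by a graph with two vertices. The graphs obtained in this way are (particular) well labelled spiders. *)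

(* Defs.v *)
From HB Require Import structures.
From mathcomp Require Import all_boot.
Set Implicit Arguments.
Unset Strict Implicit.
Unset Printing Implicit Defensive.

Record sgraph := SGraph {
  svertex :> finType;
  sedge : rel svertex;
  sedge_sym : symmetric sedge;
  sedge_irrefl : irreflexive sedge }.

Arguments sedge {s} _ _.
Notation "x -- y" := (sedge x y) (at level 30).

Definition roman2dom (G : sgraph) (f : {ffun G -> 'I_3}) : bool :=
  [forall v : G, (f v == 0 :> nat) ==>
     [exists u : G, (v -- u) && (f u == 2 :> nat)]
     || [exists x : G, [exists y : G,
          [&& x != y, v -- x, v -- y, f x == 1 :> nat & f y == 1 :> nat]]]].

Definition weight (G : sgraph) (f : {ffun G -> 'I_3}) : nat := \sum_(v : G) f v.

(* The constant function 2 is only the seed required by [arg min]; it is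
   Roman {2}-dominating, so the minimum is over a nonempty set (gammaR2P). *)
Definition gammaR2 (G : sgraph) : nat :=
  weight [arg min_(f < [ffun=> ord_max] : {ffun G -> 'I_3} | roman2dom f) weight f].

Lemma gammaR2P (G : sgraph) :
  (exists2 f : {ffun G -> 'I_3}, roman2dom f & weight f = gammaR2 G)
  /\ (forall f : {ffun G -> 'I_3}, roman2dom f -> gammaR2 G <= weight f).
Proof.
rewrite /gammaR2; case: arg_minnP => [|f hf hmin].
  by apply/forallP=> v; rewrite ffunE.
by split; [exists f | exact: hmin].
Qed.

Record thin_spider (G : sgraph) (r : nat) (s c : 'I_r -> G) (S C H : {set G})
    : Prop := ThinSpider {
  spider_size : 2 <= r;
  spider_s_inj : injective s;
  spider_c_inj : injective c;
  spider_S : S = [set s i | i : 'I_r];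
  spider_C : C = [set c i | i : 'I_r];
  spider_cover : S :|: C :|: H = [set: G];
  spider_disjSC : [disjoint S & C];
  spider_disjSH : [disjoint S & H];
  spider_disjCH : [disjoint C & H];
  spider_stable : {in S &, forall x y, ~~ (x -- y)};
  spider_clique : {in C &, forall x y, x != y -> x -- y};
  spider_HC : {in H & C, forall h x, h -- x};
  spider_HS : {in H & S, forall h x, ~~ (h -- x)};
  spider_legs : forall i j, (s i -- c j) = (i == j) }.

Section Replace.
Variables (G : sgraph) (T : {set G}) (F : {v : G | v \in T} -> sgraph).

(* Simultaneous replacement of every v in T by F v: the vertices are those of
   G outside T together with the disjoint union of the F v, v in T. *)
Definition replace_vertex : finType :=
  ({v : G | v \notin T} + {v : {v : G | v \in T} & F v})%type.

Definition replace_base (p : replace_vertex) : G :=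
  match p with inl v => val v | inr x => val (tag x) end.

Definition replace_edge (p q : replace_vertex) : bool :=
  match p, q with
  | inr x, inr y =>
      if tag x == tag y then tagged x -- tagged_as x y
      else val (tag x) -- val (tag y)
  | _, _ => replace_base p -- replace_base q
  end.

Lemma replace_edge_sym : symmetric replace_edge.
Proof.
case=> [u|[i x]] [v|[j y]] /=; try exact: sedge_sym.
case: (i =P j) => [ij|/eqP ij]; last by rewrite eq_sym (negPf ij) sedge_sym.
by case: j / ij y => y; rewrite eqxx !tagged_asE sedge_sym.
Qed.

Lemma replace_edge_irrefl : irreflexive replace_edge.
Proof.
by case=> [u|[i x]] /=; rewrite ?eqxx ?tagged_asE sedge_irrefl.
Qed.

Definition replace : sgraph := SGraph replace_edge_sym replace_edge_irrefl.

End Replace.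

(* W is the graph obtained by operation R3 on the spider with legs s_i c_i,
   where T is the set of replaced vertices and F v is the graph put in place
   of v. *)
Record opR3 (G : sgraph) (r : nat) (s c : 'I_r -> G) (T : {set G})
    (F : {v : G | v \in T} -> sgraph) (W : sgraph) : Prop := OpR3 {
  R3_legs : T \subset [set s i | i : 'I_r] :|: [set c i | i : 'I_r];
  R3_one_endpoint : forall i : 'I_r, ~~ ((s i \in T) && (c i \in T));
  R3_two_vertices : forall v, #|F v| = 2;
  R3_result : W = replace F }.

(* Main.v *)
(** Both graphs map onto [G] so that edges are determined by [G] outside the
    fibres: [G] by the identity, [W] by sending each copy back to the vertex it
    replaces. A vertex of value 0 above [s i] has all its neighbours above
    [s i] and [c i], so the part of the graph above the leg [i] has weight at
    least [min 2 n], where [n] is the size of the fibre of [s i]. Putting 2 on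
    [c i] for [i] in a nonempty set [I] of legs and 1 on [s i] for the other
    legs gives a function of weight [r + #|I|]. In [W] the two bounds meet at
    [r + t]; in [G] the first one is [r], and cannot be attained since the
    vertices of [C] would not be dominated, so that [gammaR2 G = r + 1]. *)
Require Import Defs.
From mathcomp Require Import all_boot.
From mathcomp Require Import zify.
Set Implicit Arguments.
Unset Strict Implicit.
Unset Printing Implicit Defensive.

(** This consequence of domination is all that the lower bounds use. *)
Lemma roman2dom_sum (G : sgraph) (f : {ffun G -> 'I_3}) (v : G) :
  roman2dom f -> f v = 0 :> nat -> 2 <= \sum_(u | v -- u) f u.
Proof.
move=> /forallP /(_ v) /implyP hf /eqP /hf /orP [].
  by case/existsP=> u /andP [vu /eqP fu]; rewrite (bigD1 u) //= fu leq_addr.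
case/existsP=> x /existsP [y /and5P [xy vx vy /eqP fx /eqP fy]].
rewrite (bigD1 x) //= (bigD1 y) /=; last by rewrite vy eq_sym.
by rewrite fx fy addnA leq_addr.
Qed.

(** The [r - 1] terms other than [E k] count at least 1 each; the successor avoids a truncated
    subtraction. *)
Lemma ltn_sum_geq1 (r : nat) (E : 'I_r -> nat) (k : 'I_r) :
  (forall i, 1 <= E i) -> r + E k <= (\sum_i E i).+1.
Proof.
move=> hE; rewrite (bigD1 k) //=.
have : \sum_(i < r | i != k) 1 <= \sum_(i < r | i != k) E i.
  by apply: leq_sum => i _.
rewrite sum1_card cardC1 card_ord; move: (\sum_(i < r | i != k) E i) => X; lia.
Qed.

Lemma sum_succ_mem (r : nat) (I : {set 'I_r}) :
  \sum_i (1 + (i \in I)) = r + #|I|.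
Proof.
rewrite big_split /= sum1_card card_ord -sum1_card [in RHS]big_mkcond /=.
by congr (_ + _); apply: eq_bigr => i _; case: (i \in I).
Qed.

Section ThinSpider.
Variables (G : sgraph) (r : nat) (s c : 'I_r -> G) (S C H : {set G}).
Hypothesis hG : thin_spider s c S C H.

Lemma mem_s i : s i \in S.
Proof. by rewrite (spider_S hG) imset_f. Qed.

Lemma mem_c i : c i \in C.
Proof. by rewrite (spider_C hG) imset_f. Qed.

Lemma neq_s_c i j : s i != c j.
Proof.
apply/eqP=> e; have := disjointFr (spider_disjSC hG) (mem_s i).
by rewrite e mem_c.
Qed.

Lemma spider_sum (g : G -> nat) :
  \sum_v g v = \sum_i (g (s i) + g (c i)) + \sum_(v in H) g v.
Proof.
have dSCH : [disjoint S :|: C & H].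
  rewrite -setI_eq0 setIUl setU_eq0 !setI_eq0.
  by rewrite (spider_disjSH hG) (spider_disjCH hG).
have sumU (A B : {set G}) : [disjoint A & B] ->
    \sum_(v in A :|: B) g v = \sum_(v in A) g v + \sum_(v in B) g v.
  by move=> dAB; rewrite -bigU //; apply: eq_bigl => v; rewrite !inE.
have -> : \sum_v g v = \sum_(v in S :|: C :|: H) g v.
  by apply: eq_bigl => v; rewrite (spider_cover hG) inE.
rewrite sumU // sumU ?(spider_disjSC hG) //.
rewrite {1}(spider_S hG) (spider_C hG) big_split /=.
rewrite (big_imset _ (in2W (spider_s_inj hG))).
by rewrite (big_imset _ (in2W (spider_c_inj hG))).
Qed.

Lemma spider_vertexP v :
  [\/ exists i, v = s i, exists i, v = c i | v \in H].
Proof.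
have : v \in S :|: C :|: H by rewrite (spider_cover hG) inE.
rewrite (spider_S hG) (spider_C hG) !inE.
case/orP=> [/orP [/imsetP [i _ ->]|/imsetP [i _ ->]]|hv].
- by constructor 1; exists i.
- by constructor 2; exists i.
- by constructor 3.
Qed.

Lemma s_neighbour i v : s i -- v -> v = c i.
Proof.
case: (spider_vertexP v) => [[j ->]|[j ->]|hv].
- by rewrite (negPf (spider_stable hG (mem_s i) (mem_s j))).
- by rewrite (spider_legs hG) => /eqP ->.
- by rewrite sedge_sym (negPf (spider_HS hG hv (mem_s i))).
Qed.

Section Fibration.
Variables (W : sgraph) (b : W -> G).
Hypothesis hb : forall w w', b w != b w' -> w -- w' = b w -- b w'.

Lemma leg_weight_ge (f : {ffun W -> 'I_3}) i : roman2dom f ->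
  minn 2 #|[set w | b w == s i]|
    <= \sum_(w | b w == s i) f w + \sum_(w | b w == c i) f w.
Proof.
move=> hf; rewrite geq_min.
(* Without a zero above [s i], every vertex of that fibre contributes at least 1. Otherwise the
   neighbours of a zero carry 2. *)
case: (boolP [exists w, (b w == s i) && (f w == 0 :> nat)]); last first.
  move/existsPn=> h; apply/orP; right; apply: leq_trans (leq_addr _ _).
  rewrite -sum1_card big_mkcond /= [leqRHS]big_mkcond /=.
  by apply: leq_sum => w _; rewrite inE; have := h w; case: eqP => //= _; lia.
case/existsP=> w /andP [/eqP bw /eqP fw]; apply/orP; left.
apply: leq_trans (roman2dom_sum hf fw) _.
rewrite big_mkcond [X in _ <= X + _]big_mkcond [X in _ <= _ + X]big_mkcond /=.
rewrite -big_split /=; apply: leq_sum => u _; case: ifP => // wu.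
have [e|ne] := eqVneq (b u) (s i); first by rewrite leq_addr.
have /s_neighbour -> : s i -- b u by rewrite -bw -hb // bw eq_sym.
by rewrite eqxx.
Qed.

Lemma weight_fibres (f : {ffun W -> 'I_3}) :
  weight f = \sum_v \sum_(w | b w == v) f w.
Proof. by rewrite /weight (partition_big b predT). Qed.

Lemma weight_ge_legs (f : {ffun W -> 'I_3}) : roman2dom f ->
  \sum_i minn 2 #|[set w | b w == s i]| <= weight f.
Proof.
move=> hf; rewrite weight_fibres spider_sum; apply: leq_trans (leq_addr _ _).
by apply: leq_sum => i _; exact: leg_weight_ge.
Qed.

(** The fibre of [s i] may have any size for [i] in [I], since it then receives the value 0. *)
Lemma gammaR2_le_legs (I : {set 'I_r}) :
  I != set0 ->
  (forall i, i \notin I -> #|[set w | b w == s i]| = 1) ->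
  (forall i, #|[set w | b w == c i]| = 1) ->
  gammaR2 W <= r + #|I|.
Proof.
move=> /set0Pn [k kI] hs hc.
pose g v := if v \in c @: I then 2 else nat_of_bool (v \in s @: ~: I).
pose f : {ffun W -> 'I_3} := [ffun w => inord (g (b w))].
have fE w : f w = g (b w) :> nat.
  by rewrite ffunE inordK // /g; case: ifP => // _; case: (_ \in _).
have gs i : g (s i) = (i \notin I).
  rewrite /g ifF; first by rewrite (mem_imset _ _ (spider_s_inj hG)) inE.
  by apply/imsetP=> -[j _ e]; have := neq_s_c i j; rewrite e eqxx.
have gc i : g (c i) = if i \in I then 2 else 0.
  rewrite /g (mem_imset _ _ (spider_c_inj hG)); case: ifP => // _.
  suff -> : (c i \in s @: ~: I) = false by [].
  by apply/imsetP=> -[j _ e]; have := neq_s_c j i; rewrite e eqxx.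
have gH v : v \in H -> g v = 0.
  move=> hv; rewrite /g ifF.
    suff -> : (v \in s @: ~: I) = false by [].
    apply/imsetP=> -[j _ e].
    by have := disjointFr (spider_disjSH hG) (mem_s j); rewrite -e hv.
  apply/imsetP=> -[j _ e].
  by have := disjointFr (spider_disjCH hG) (mem_c j); rewrite -e hv.
have fibreE v : \sum_(w | b w == v) f w = #|[set w | b w == v]| * g v.
  rewrite -sum_nat_const.
  by apply: eq_big => [w|w /eqP <-]; rewrite ?inE // fE.
(* The single vertex above [c i] has value 2, and adjacency lifts from [G] because [b w] differs
   from [c i]. *)
have dominated w i : b w -- c i -> i \in I ->
    [exists u, (w -- u) && (f u == 2 :> nat)].
  move=> wi iI; have /eqP/cards1P [u hu] := hc i.
  have /eqP bu : b u == c i by move: (set11 u); rewrite -hu inE.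
  apply/existsP; exists u; rewrite fE bu gc iI eqxx andbT hb bu //.
  by apply: contraTneq wi => ->; rewrite sedge_irrefl.
have hf : roman2dom f.
  apply/forallP=> w; apply/implyP; rewrite fE => /eqP gw; apply/orP; left.
  case: (spider_vertexP (b w)) => [[i e]|[i e]|hw].
  - apply: (dominated w i); first by rewrite e (spider_legs hG).
    by move: gw; rewrite e gs; case: (i \in I).
  (* Zeros above [C] or [H] are all dominated from leg [k], which is where [I] being nonempty
     matters. *)
  - apply: (dominated w k) => //; rewrite e.
    apply: (spider_clique hG); rewrite ?mem_c //.
    by apply: contraPneq gw => ck; rewrite e ck gc kI.
  - by apply: (dominated w k) => //; apply: (spider_HC hG) => //; exact: mem_c.
apply: leq_trans ((gammaR2P W).2 f hf) _.
rewrite weight_fibres spider_sum [X in _ + X]big1 => [|v hv]; last first.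
  by rewrite fibreE gH ?muln0.
rewrite addn0 -sum_succ_mem; apply: leq_sum => i _; rewrite !fibreE gs gc hc mul1n.
by case: (boolP (i \in I)) => iI; rewrite ?muln0 // hs.
Qed.

End Fibration.

Lemma weight_ge_spider (f : {ffun G -> 'I_3}) : roman2dom f -> r.+1 <= weight f.
Proof.
move=> hf.
have leg i : 1 <= f (s i) + f (c i).
  have := @leg_weight_ge G id (fun _ _ _ => erefl) f i hf.
  rewrite !big_pred1_eq; apply: leq_trans.
  by rewrite leq_min /= card_gt0; apply/set0Pn; exists (s i); rewrite inE /=.
(* Each leg weighs at least 1, so one extra unit, on some leg or in [H], suffices. *)
suff [k hk] : exists k, 2 <= f (s k) + f (c k) + \sum_(v in H) f v.
  rewrite /weight (spider_sum (fun v => f v)).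
  have := ltn_sum_geq1 k leg; lia.
case: (boolP [exists k, 2 <= f (s k) + f (c k)]) => [/existsP [k hk]|/existsPn h].
  by exists k; exact: leq_trans (leq_addr _ _).
(* When every leg weighs at most 1, a zero at [s k] would force 2 on its only neighbour [c k]; hence
   [s k] takes the whole weight of its leg. *)
have fc k : f (c k) = 0 :> nat.
  have [fs0|] := eqVneq (f (s k) : nat) 0; last by have := h k; lia.
  have := roman2dom_sum hf fs0.
  rewrite (big_pred1 (c k)) => [|v]; first by have := h k; lia.
  by apply/idP/eqP => [/s_neighbour //|->]; rewrite (spider_legs hG) eqxx.
have k : 'I_r := Ordinal (ltnW (spider_size hG)).
exists k; apply: leq_trans (roman2dom_sum hf (fc k)) _.
rewrite big_mkcond /= spider_sum; apply: leq_add; last first.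
  by apply: leq_sum => v _; case: ifP.
(* Another leg adds nothing around [c k]: [s i] is not adjacent to it and [c i] has value 0. *)
rewrite (bigD1 k) //= big1 ?addn0 => [|i ik].
  by apply: leq_add; case: ifP.
rewrite sedge_sym (spider_legs hG) (negPf ik) add0n.
by case: ifP => // _; exact: fc.
Qed.

(** The upper bound takes the identity as [b] and a single leg as [I]. *)
Lemma gammaR2_spider : gammaR2 G = r.+1.
Proof.
apply/eqP; rewrite eqn_leq; apply/andP; split; last first.
  by have [f hf <-] := (gammaR2P G).1; exact: weight_ge_spider.
pose k : 'I_r := Ordinal (ltnW (spider_size hG)).
rewrite -addn1 -(cards1 k).
have fib (v : G) : #|[set w | w == v]| = 1.
  by apply/eqP/cards1P; exists v; apply/setP=> w; rewrite !inE.
apply: (@gammaR2_le_legs G id) => //.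
by apply/set0Pn; exists k; rewrite set11.
Qed.

End ThinSpider.

Section Replace.
Variables (G : sgraph) (T : {set G}) (F : {v : G | v \in T} -> sgraph).

Lemma replace_base_edge (w w' : replace F) :
  replace_base w != replace_base w' ->
  w -- w' = replace_base w -- replace_base w'.
Proof.
case: w w' => [u|x] [v|y] //= h; rewrite /sedge /= ifF //.
by apply: contraNF h => /eqP ->.
Qed.

Lemma card_fibre_kept v : v \notin T ->
  #|[set w : replace F | replace_base w == v]| = 1.
Proof.
move=> vT; apply/eqP/cards1P.
exists (inl (Sub v vT) : replace F); apply/setP=> -[u|x]; rewrite !inE //=.
apply: contraNF vT => /eqP <-; exact: valP.
Qed.

Lemma card_fibre_replaced (v : {v : G | v \in T}) :
  #|[set w : replace F | replace_base w == val v]| = #|F v|.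
Proof.
pose h (x : F v) : replace F := inr (Tagged (fun v => F v : finType) x).
have h_inj : injective h.
  by move=> x y [] /eqP; rewrite eq_Tagged /= => /eqP.
rewrite -(card_imset _ h_inj); apply: eq_card => w; rewrite inE.
apply/eqP/imsetP => [|[x _ ->] //].
case: w => [u|[i x]] /= e; first by have := valP u; rewrite /= e (valP v).
(* Equal base vertices give equal indices in the subtype, so [x] can be read as a vertex of
   [F v]. *)
have {}e := val_inj e; rewrite /h {h h_inj}; case: v / e.
by exists x.
Qed.

End Replace.

Theorem proposition3p5 (G : sgraph) (r : nat) (s c : 'I_r -> G)
    (S C H : {set G}) (hG : thin_spider s c S C H)
    (T : {set G}) (F : {v : G | v \in T} -> sgraph) (W : sgraph)
    (hW : opR3 s c F W) (t : nat) (ht : 1 <= t)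
    (hTS : T \subset S) (hT : #|T| = t) :
  gammaR2 W = gammaR2 G + t - 1.
Proof.
rewrite (gammaR2_spider hG) addSn subn1 /=.
have hF := R3_two_vertices hW; have := R3_result hW => {hW} ?; subst W.
pose I := [set i | s i \in T].
have TI : T = s @: I.
  apply/setP=> v; apply/idP/imsetP => [vT|[i + ->]]; last by rewrite inE.
  have := subsetP hTS v vT; rewrite (spider_S hG) => /imsetP [i _ e].
  by exists i; rewrite // inE -e.
have cI : #|I| = t by rewrite -hT {1}TI card_imset //; exact: spider_s_inj hG.
have cT i : c i \notin T.
  apply/negP=> /(subsetP hTS) cS.
  by have := disjointFr (spider_disjSC hG) cS; rewrite (mem_c hG).
(* These sizes are at most 2, so [minn 2] leaves them unchanged and the lower bound sums to
   [r + #|I|]. *)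
have fs i : #|[set w : replace F | replace_base w == s i]| = 1 + (i \in I).
  rewrite inE; case: (boolP (s i \in T)) => sT; last exact: card_fibre_kept.
  exact: etrans (card_fibre_replaced F (Sub (s i) sT)) (hF _).
apply/eqP; rewrite eqn_leq; apply/andP; split.
  rewrite -cI; apply: (gammaR2_le_legs hG (@replace_base_edge _ _ F)).
  (* The hypothesis [1 <= t] provides a leg carrying the value 2. *)
  - by rewrite -card_gt0 cI.
  - by move=> i /negPf iI; rewrite fs iI.
  - by move=> i; exact: card_fibre_kept.
have [f hf <-] := (gammaR2P (replace F)).1.
apply: leq_trans (weight_ge_legs hG (@replace_base_edge _ _ F) hf).
by rewrite -cI -sum_succ_mem; apply: leq_sum => i _; rewrite fs; case: (i \in I).
Qed.
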